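(* There exists a period tripling infinitely renormalizable $C^{1+Lip}$ unimodal map $\mathcal F_{s^*}:[0,1]\to[0,1]$ with a quadratic tip, extending $f_{s^*}$, such that $R\mathcal F_{s^*}=\mathcal F_{s^*}$.
   Context: A unimodal map is a $C^1$ map $f:[0,1]\to[0,1]$ with a unique critical point $c$, normalized here by $f(c)=1$, $f(1)=0$. It is $C^{1+Lip}$ if its derivative is Lipschitz. It has a quadratic tip if there are a sequence $y_n\to c$ ($y_n\ne c$) and $l>0$ with $\lim_{n\to\infty}\frac{f(y_n)-f(c)}{(y_n-c)^2}=-l$. Period tripling renormalization: $f$ is period tripling renormalizable if $f(0)<c<f^4(0)$ and, with $J=[f(0),f^4(0)]$ (a proper subinterval; note $f(0)=f^3(c)$), the intervals $f^2(J),J,f(J)$ have pairwise disjoint interiors, lie in this order from left to right, and $f^3(J)\subset J$. Then $Rf=h^{-1}\circ f^3\circ h$ with $h:[0,1]\to J$ the orientation reversing affine homeomorphism. $f$ is period tripling infinitely renormalizable if $R^nf$ is period tripling renormalizable for every $n\ge0$ and the lengths of the corresponding nested intervals $J_n\ni c$ (on which $f^{3^n}$ is affinely conjugate to $R^nf$) tend to $0$. The map $f_{s^*}$: for $c\in[0,\tfrac12]$ let $u_c(x)=1-\left(\frac{x-c}{1-c}\right)^2$ on $[0,1]$, with iterates $u_c^k$. Let $F_d$ be the set of $c\in(0,\tfrac12)$ with $u_c^3(0)>0$, $u_c^4(0)-u_c(0)>0$, $1-u_c^2(0)>0$, $u_c(0)-u_c^3(0)>0$, $u_c^2(0)-u_c^4(0)>0$.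 Let $c^*=0.440262\ldots$ be the unique $c\in F_d$ with $\frac{u_c^4(0)-c}{u_c^4(0)-u_c(0)}=c$, and $(s_1^*,s_2^*,s_3^* )=\big(u_{c^*}^3(0),u_{c^*}^4(0)-u_{c^*}(0),1-u_{c^*}^2(0)\big)$. With $\tilde s_1(t)=s_1^*(1-t)$, $\tilde s_2(t)=u_{c^*}(0)+s_2^*(1-t)$, $\tilde s_3(t)=1-s_3^*(1-t)$ and $I_i^n=\tilde s_2^{\,n-1}\circ\tilde s_i([0,1])$, $n\ge1$, the map $f_{s^*}:\bigcup_{n\ge1}(I_1^n\cup I_3^n)\to[0,1]$ is affine on each $I_1^n$ and $I_3^n$ and agrees with $u_{c^*}$ at their endpoints. *)

(* Defs.v *)
From Stdlib Require Import Reals.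
Open Scope R_scope.

(* Maps of [0,1] are total functions R -> R of which only the values on [0,1]
   matter; identities between such maps are required on [0,1] only. *)
Definition I01 (x : R) : Prop := 0 <= x <= 1.

(* [D_in f df I01] is differentiability within [0,1], hence one-sided at the
   end points. *)
Definition derivative01 (f df : R -> R) : Prop :=
  forall x, I01 x -> D_in f df I01 x.

Definition unimodal (f : R -> R) (c : R) : Prop :=
  (forall x, I01 x -> I01 (f x)) /\
  (exists df : R -> R,
     derivative01 f df /\
     (forall x, I01 x -> continue_in df I01 x) /\
     I01 c /\
     (forall x, I01 x -> (df x = 0 <-> x = c))) /\
  f c = 1 /\ f 1 = 0.

Definition C1Lip (f : R -> R) : Prop :=
  exists (df : R -> R) (K : R),
    derivative01 f df /\
    (forall x y, I01 x -> I01 y -> Rabs (df x - df y) <= K * Rabs (x - y)).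

Definition quadratic_tip (f : R -> R) (c : R) : Prop :=
  exists (y : nat -> R) (l : R),
    0 < l /\
    (forall n, I01 (y n) /\ y n <> c) /\
    Un_cv y c /\
    Un_cv (fun n => (f (y n) - f c) / (y n - c) ^ 2) (- l).

Definition disjoint_interiors (A B : R -> Prop) : Prop :=
  forall x, ~ (interior A x /\ interior B x).

Definition left_of (A B : R -> Prop) : Prop :=
  forall a b, A a -> B b -> a <= b.

Definition J (f : R -> R) (x : R) : Prop := f 0 <= x <= Nat.iter 4 f 0.

Definition renormalizable (f : R -> R) (c : R) : Prop :=
  unimodal f c /\
  f 0 < c < Nat.iter 4 f 0 /\
  included (J f) I01 /\ (exists x, I01 x /\ ~ J f x) /\
  (let J1 := image_dir f (J f) in
   let J2 := image_dir (Nat.iter 2 f) (J f) in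
   disjoint_interiors J2 (J f) /\
   disjoint_interiors (J f) J1 /\
   disjoint_interiors J2 J1 /\
   left_of J2 (J f) /\ left_of (J f) J1) /\
  included (image_dir (Nat.iter 3 f) (J f)) (J f).

(* The orientation reversing affine map sending [0,1] onto J, and its inverse. *)
Definition h (f : R -> R) (t : R) : R :=
  Nat.iter 4 f 0 - (Nat.iter 4 f 0 - f 0) * t.

Definition h_inv (f : R -> R) (x : R) : R :=
  (Nat.iter 4 f 0 - x) / (Nat.iter 4 f 0 - f 0).

Definition renorm (f : R -> R) (x : R) : R :=
  h_inv f (Nat.iter 3 f (h f x)).

(* [h_comp f n] is h_f o h_(Rf) o ... o h_(R^(n-1) f); it sends [0,1] onto J_n
   and conjugates R^n f to f^(3^n) on J_n. *)
Fixpoint h_comp (f : R -> R) (n : nat) (t : R) : R :=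
  match n with
  | O => t
  | S m => h_comp f m (h (Nat.iter m renorm f) t)
  end.

Definition length_J (f : R -> R) (n : nat) : R :=
  Rabs (h_comp f n 1 - h_comp f n 0).

Definition infinitely_renormalizable (f : R -> R) : Prop :=
  (forall n, exists c, renormalizable (Nat.iter n renorm f) c) /\
  Un_cv (length_J f) 0.

Definition u (c x : R) : R := 1 - ((x - c) / (1 - c)) ^ 2.

Definition uk (c : R) (k : nat) : R := Nat.iter k (u c) 0.

Definition F_d (c : R) : Prop :=
  0 < c < 1 / 2 /\
  uk c 3 > 0 /\
  uk c 4 - uk c 1 > 0 /\
  1 - uk c 2 > 0 /\
  uk c 1 - uk c 3 > 0 /\
  uk c 2 - uk c 4 > 0.

Definition c_star_eq (c : R) : Prop :=
  F_d c /\ (uk c 4 - c) / (uk c 4 - uk c 1) = c.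

Definition s1 (c : R) : R := uk c 3.
Definition s2 (c : R) : R := uk c 4 - uk c 1.
Definition s3 (c : R) : R := 1 - uk c 2.

Definition st1 (c t : R) : R := s1 c * (1 - t).
Definition st2 (c t : R) : R := uk c 1 + s2 c * (1 - t).
Definition st3 (c t : R) : R := 1 - s3 c * (1 - t).

Definition affine_on (g : R -> R) (A : R -> Prop) : Prop :=
  exists a b, forall x, A x -> g x = a * x + b.

(* For sigma affine, [g] is affine on the interval sigma([0,1]) and equals u_c
   at its end points sigma(0) and sigma(1). *)
Definition affine_agreeing (c : R) (g sigma : R -> R) : Prop :=
  affine_on g (image_dir sigma I01) /\
  g (sigma 0) = u c (sigma 0) /\
  g (sigma 1) = u c (sigma 1).

(* The interval I_i^(n+1) is the image of [0,1] under [st2^n o st_i].  The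
   conditions below determine f_s* on the union of the I_1^n and I_3^n, so a
   map of [0,1] extends f_s* exactly when it satisfies them. *)
Definition extends_f_s (c : R) (g : R -> R) : Prop :=
  forall n : nat,
    affine_agreeing c g (fun t => Nat.iter n (st2 c) (st1 c t)) /\
    affine_agreeing c g (fun t => Nat.iter n (st2 c) (st3 c t)).

(* Main.v *)
Require Import Defs.
From Stdlib Require Import Reals Lra Lia IndefiniteDescription.
Open Scope R_scope.

(** Why the theorem is true.  Write [s = s_2] and [r = s_1] at [c = c_star].
    The equation defining [c_star] says that the orientation reversing affine
    map [flip] from [[0, 1]] onto [J = [lo, hi]] fixes [c], that is,
    [flip t = c - s (t - c)].  As [u c] is quadratic around [c], this forces
    [s_3 = s^2].  On the way back to [J] a map extending [f_s] is affine: it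
    sends [[1 - s^2, 1]] to [[0, r]] and [[0, r]] to [J].  Therefore it is a
    fixed point of the renormalization as soon as
      [1 - F (flip t) = s^2 (1 - F t)]   on [[0, 1]],
    an equation that determines [F] on [J] from its values outside [J], where
    it can be prescribed.  It is chosen there affine on [[0, r]] and
    [[1 - s^2, 1]], as it must be, and a monotone cubic on each of the two gaps
    [[r, lo]] and [[hi, 1 - s^2]], with the slopes at the end points that the
    differentiated equation [F' (flip t) = - s F' t] imposes.

    The regularity at [c], where infinitely many pieces accumulate, rests on
    the exact balance between the factor [s] on lengths and [s^2] on values.
    The estimate
      [|F y - F x - F' x (y - x)| <= K (y - x)^2]
    is preserved, with the same [K], by this rescaling ([taylor_rescale]) and
    by gluing adjacent pieces to first order ([taylor_glue]), hence by the
    operator [step] which fills [J] with a rescaled copy of a map.  The iterates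
    of [step] are eventually constant at every point, and their limit
    ([fixed_jet_exists]) satisfies the estimate, which contains [C^{1+Lip}].
    Statements about all of [[0, 1]], such as the uniqueness of the critical
    point, follow from what holds outside [J] and its invariance under [flip]
    ([selfsimilar_induction]).  The combinatorics of the renormalization and
    the values at the affine pieces are read off from the equation
    ([selfsimilar_renorm], [selfsimilar_renormalizable],
    [selfsimilar_extends]), and the quotient defining the quadratic tip is
    constant along the orbit of [0] under [flip].

    For the parameter, [a = 1 / (1 - c)] turns the equation of [c_star] into a
    polynomial one, [balance a = 0].  It has a root by the intermediate value
    theorem, and the order of the orbit of [0] required by [F_d] confines [a]
    to an interval on which the equation, with its trivial factor removed, is
    monotone ([c_star_range], [reduced_solution_unique]). *)

(** * Maps with a quadratic Taylor estimate *)

Lemma Rabs_bounds x e : Rabs x <= e -> - e <= x <= e.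
Proof. unfold Rabs. destruct (Rcase_abs x); lra. Qed.

Record jet := Jet { val : R -> R; der : R -> R }.

(** This estimate serves for [C^{1+Lip}]: it contains differentiability, it
    makes [der] Lipschitz (exchange [x] and [y]), it mentions no derivative of
    a limit or of a piecewise function, and the same constant [K] survives
    gluing, the rescaling in [step], and pointwise limits. *)
Definition taylor (K a b : R) (j : jet) : Prop :=
  forall x y, a <= x <= b -> a <= y <= b ->
    Rabs (val j y - val j x - der j x * (y - x)) <= K * (y - x) ^ 2.

Lemma taylor_weaken K K' a b j : K <= K' -> taylor K a b j -> taylor K' a b j.
Proof.
  intros HK Hj x y Hx Hy.
  specialize (Hj x y Hx Hy).
  pose proof (pow2_ge_0 (y - x)). nra.
Qed.

(** Exchanging the two points and adding the estimates bounds
    [(der x - der y) * (y - x)]. *)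
Lemma taylor_lipschitz K a b j : taylor K a b j ->
  forall x y, a <= x <= b -> a <= y <= b ->
  Rabs (der j x - der j y) <= 2 * K * Rabs (x - y).
Proof.
  intros Hj x y Hx Hy.
  destruct (Req_dec x y) as [->|Hne].
  { rewrite !Rminus_diag, Rabs_R0. lra. }
  pose proof (Hj x y Hx Hy) as H1.
  pose proof (Hj y x Hy Hx) as H2.
  apply Rmult_le_reg_r with (Rabs (x - y)); [apply Rabs_pos_lt; lra|].
  rewrite <- Rabs_mult, Rmult_assoc, <- Rabs_mult.
  rewrite (Rabs_pos_eq ((x - y) * (x - y))) by nra.
  apply Rabs_bounds in H1. apply Rabs_bounds in H2.
  apply Rabs_le. nra.
Qed.

Lemma taylor_D_in K j x :
  0 <= K -> taylor K 0 1 j -> I01 x -> D_in (val j) (der j) I01 x.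
Proof.
  intros HK Hj Hx eps Heps.
  exists (eps / (K + 1)). split.
  { apply Rdiv_lt_0_compat; lra. }
  intros y [[Hy Hne] Hd]. simpl in *. unfold Rdist in *.
  specialize (Hj x y Hx Hy).
  replace ((val j y - val j x) / (y - x) - der j x)
    with ((val j y - val j x - der j x * (y - x)) / (y - x)) by (field; lra).
  assert (Hpos : 0 < Rabs (y - x)) by (apply Rabs_pos_lt; lra).
  unfold Rdiv at 1. rewrite Rabs_mult, Rabs_inv.
  apply Rmult_lt_reg_r with (Rabs (y - x)); [exact Hpos|].
  rewrite Rmult_assoc, Rinv_l, Rmult_1_r by lra.
  rewrite <- (pow2_abs (y - x)) in Hj.
  assert (Hd' : Rabs (y - x) * (K + 1) < eps).
  { apply Rmult_lt_reg_r with (/ (K + 1)); [apply Rinv_0_lt_compat; lra|].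
    rewrite Rmult_assoc, Rinv_r, Rmult_1_r by lra. exact Hd. }
  nra.
Qed.

Lemma lipschitz_continue_in (df : R -> R) (K : R) :
  0 <= K ->
  (forall x y, I01 x -> I01 y -> Rabs (df x - df y) <= K * Rabs (x - y)) ->
  forall x, I01 x -> continue_in df I01 x.
Proof.
  intros HK HL x Hx eps Heps.
  exists (eps / (K + 1)). split.
  { apply Rdiv_lt_0_compat; lra. }
  intros y [[Hy _] Hd]. simpl in *. unfold Rdist in *.
  specialize (HL y x Hy Hx).
  assert (Hd' : Rabs (y - x) * (K + 1) < eps).
  { apply Rmult_lt_reg_r with (/ (K + 1)); [apply Rinv_0_lt_compat; lra|].
    rewrite Rmult_assoc, Rinv_r, Rmult_1_r by lra. exact Hd. }
  pose proof (Rabs_pos (y - x)). nra.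
Qed.

Definition glue (b : R) (j k : jet) : jet :=
  Jet (fun x => if Rle_dec x b then val j x else val k x)
      (fun x => if Rle_dec x b then der j x else der k x).

(** The constant is not spoilt: for [x <= b <= y] the two errors from [b]
    contribute [K (b - x)^2 + K (y - b)^2], and replacing [der x] by [der b]
    costs [2 K (b - x) (y - b)], in total [K (y - x)^2]. *)
Lemma taylor_glue K a b d j k :
  taylor K a b j -> taylor K b d k ->
  val j b = val k b -> der j b = der k b ->
  taylor K a d (glue b j k).
Proof.
  intros Hj Hk Hv Hd x y Hx Hy.
  assert (Hlip := taylor_lipschitz _ _ _ _ Hj).
  assert (Hlip' := taylor_lipschitz _ _ _ _ Hk).
  simpl. destruct (Rle_dec x b), (Rle_dec y b).
  - apply Hj; lra.
  - pose proof (Hj x b ltac:(lra) ltac:(lra)) as E1.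
    pose proof (Hk b y ltac:(lra) ltac:(lra)) as E2.
    pose proof (Hlip b x ltac:(lra) ltac:(lra)) as E3.
    rewrite (Rabs_pos_eq (b - x)) in E3 by lra.
    rewrite <- Hv, <- Hd in E2.
    apply Rabs_bounds in E1, E2, E3. apply Rabs_le.
    split; nra.
  - pose proof (Hk x b ltac:(lra) ltac:(lra)) as E1.
    pose proof (Hj b y ltac:(lra) ltac:(lra)) as E2.
    pose proof (Hlip' b x ltac:(lra) ltac:(lra)) as E3.
    rewrite (Rabs_left1 (b - x)) in E3 by lra.
    rewrite <- Hv in E1. rewrite <- Hd in E3.
    apply Rabs_bounds in E1, E2, E3. apply Rabs_le.
    split; nra.
  - apply Hk; lra.
Qed.

Definition line (A p a : R) : jet := Jet (fun x => A + p * (x - a)) (fun _ => p).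

Lemma taylor_line K A p a b d : 0 <= K -> taylor K b d (line A p a).
Proof.
  intros HK x y _ _. simpl.
  replace (A + p * (y - a) - (A + p * (x - a)) - p * (y - x)) with 0 by ring.
  rewrite Rabs_R0. pose proof (pow2_ge_0 (y - x)). nra.
Qed.

(** * Cubic interpolation *)

(** The cubic on [[a, b]] with values [A], [B] and slopes [p], [q] at the end
    points, in Bernstein form.  Its control ordinates are [A], [bez1], [bez2],
    [B]; when they are ordered, so that the control polygon is monotone, the
    cubic is monotone and stays between [A] and [B]. *)
Definition bez1 (a b A p : R) : R := A + p * (b - a) / 3.
Definition bez2 (a b B q : R) : R := B - q * (b - a) / 3.

Definition bezier (a b A p B q : R) : jet :=
  let y1 := bez1 a b A p in
  let y2 := bez2 a b B q in
  Jet (fun x => let t := (x - a) / (b - a) in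
         A * (1 - t) ^ 3 + 3 * y1 * (t * (1 - t) ^ 2)
         + 3 * y2 * (t ^ 2 * (1 - t)) + B * t ^ 3)
      (fun x => let t := (x - a) / (b - a) in
         3 / (b - a) * ((y1 - A) * (1 - t) ^ 2 + 2 * (y2 - y1) * (t * (1 - t))
                        + (B - y2) * t ^ 2)).

Lemma bezier_left a b A p B q : a < b ->
  val (bezier a b A p B q) a = A /\ der (bezier a b A p B q) a = p.
Proof. intros H. unfold bezier, bez1, bez2; simpl. split; field; lra. Qed.

Lemma bezier_right a b A p B q : a < b ->
  val (bezier a b A p B q) b = B /\ der (bezier a b A p B q) b = q.
Proof. intros H. unfold bezier, bez1, bez2; simpl. split; field; lra. Qed.

Lemma unit_parameter a b x : a < b -> a <= x <= b -> 0 <= (x - a) / (b - a) <= 1.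
Proof.
  intros Hab Hx. split.
  - apply Rmult_le_pos; [lra|]. left; apply Rinv_0_lt_compat; lra.
  - apply Rmult_le_reg_r with (b - a); [lra|].
    unfold Rdiv; rewrite Rmult_assoc, Rinv_l; lra.
Qed.

Lemma taylor_bezier a b A p B q : a < b ->
  exists K, taylor K a b (bezier a b A p B q).
Proof.
  intros Hab.
  set (y1 := bez1 a b A p). set (y2 := bez2 a b B q).
  set (e := 3 * (A - 2 * y1 + y2)). set (k := B - 3 * y2 + 3 * y1 - A).
  exists ((Rabs e + 3 * Rabs k) / (b - a) ^ 2).
  intros x y Hx Hy. unfold bezier; cbn -[pow]. fold y1 y2.
  assert (Ht := unit_parameter a b x Hab Hx).
  assert (Hs := unit_parameter a b y Hab Hy).
  (* In the parameter [t] the cubic has second and third order coefficients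
     [e] and [k], so its Taylor error is [(s - t)^2 (e + k (s + 2 t))]. *)
  set (t := (x - a) / (b - a)) in *. set (s := (y - a) / (b - a)) in *.
  assert (Hyx : y - x = (b - a) * (s - t)) by (unfold s, t; field; lra).
  rewrite Hyx.
  match goal with |- Rabs ?E <= _ =>
    replace E with ((s - t) ^ 2 * (e + k * (s + 2 * t)))
      by (unfold e, k; field; lra) end.
  replace ((Rabs e + 3 * Rabs k) / (b - a) ^ 2 * ((b - a) * (s - t)) ^ 2)
    with ((s - t) ^ 2 * (Rabs e + 3 * Rabs k)) by (field; lra).
  rewrite Rabs_mult, (Rabs_pos_eq ((s - t) ^ 2)) by apply pow2_ge_0.
  apply Rmult_le_compat_l; [apply pow2_ge_0|].
  eapply Rle_trans; [apply Rabs_triang|].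
  rewrite Rabs_mult, (Rabs_pos_eq (s + 2 * t)) by lra.
  pose proof (Rabs_pos k). nra.
Qed.

Lemma bezier_I01 a b A p B q x : a < b -> a <= x <= b ->
  I01 A -> I01 (bez1 a b A p) -> I01 (bez2 a b B q) -> I01 B ->
  I01 (val (bezier a b A p B q) x).
Proof.
  unfold I01. intros Hab Hx HA H1 H2 HB.
  assert (Ht := unit_parameter a b x Hab Hx).
  unfold bezier; cbn -[pow].
  set (y1 := bez1 a b A p) in *. set (y2 := bez2 a b B q) in *.
  set (t := (x - a) / (b - a)) in *.
  (* The Bernstein weights are nonnegative and add up to 1. *)
  assert (W0 : 0 <= (1 - t) ^ 3) by (apply pow_le; lra).
  assert (W1 : 0 <= t * (1 - t) ^ 2) by (apply Rmult_le_pos; [|apply pow_le]; lra).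
  assert (W2 : 0 <= t ^ 2 * (1 - t)) by (apply Rmult_le_pos; [apply pow_le|]; lra).
  assert (W3 : 0 <= t ^ 3) by (apply pow_le; lra).
  assert (WS : (1 - t) ^ 3 + 3 * (t * (1 - t) ^ 2) + 3 * (t ^ 2 * (1 - t)) + t ^ 3 = 1)
    by ring.
  split; nra.
Qed.

Lemma bezier_increasing a b A p B q x : a < b -> a <= x <= b ->
  0 < p -> bez1 a b A p <= bez2 a b B q -> 0 < q ->
  0 < der (bezier a b A p B q) x.
Proof.
  intros Hab Hx Hp H12 Hq.
  assert (Ht := unit_parameter a b x Hab Hx).
  unfold bezier; cbn -[pow].
  set (t := (x - a) / (b - a)) in *.
  apply Rmult_lt_0_compat; [apply Rdiv_lt_0_compat; lra|].
  replace (bez1 a b A p - A) with (p * (b - a) / 3) by (unfold bez1; ring).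
  replace (B - bez2 a b B q) with (q * (b - a) / 3) by (unfold bez2; ring).
  assert (0 < p * (b - a) / 3) by nra.
  assert (0 < q * (b - a) / 3) by nra.
  assert (0 <= t * (1 - t)) by nra.
  destruct (Rle_dec t (1 / 2)).
  - assert (0 < (1 - t) ^ 2) by nra. assert (0 <= t ^ 2) by nra. nra.
  - assert (0 <= (1 - t) ^ 2) by nra. assert (0 < t ^ 2) by nra. nra.
Qed.

Lemma bezier_opp a b A p B q x : a < b ->
  der (bezier a b (- A) (- p) (- B) (- q)) x = - der (bezier a b A p B q) x.
Proof. intros H. unfold bezier, bez1, bez2; simpl. field; lra. Qed.

Lemma bezier_decreasing a b A p B q x : a < b -> a <= x <= b ->
  p < 0 -> bez2 a b B q <= bez1 a b A p -> q < 0 ->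
  der (bezier a b A p B q) x < 0.
Proof.
  intros Hab Hx Hp H12 Hq.
  assert (0 < der (bezier a b (- A) (- p) (- B) (- q)) x).
  { apply bezier_increasing; try lra. unfold bez1, bez2 in *. lra. }
  rewrite bezier_opp in H by exact Hab. lra.
Qed.
(** * The fixed point of the renormalization *)

(** In these coordinates the renormalization interval is [[lo, hi]] and
    [flip] is the orientation reversing affine map from [[0, 1]] onto it; that
    [flip] fixes the critical point [c] is the equation defining [c_star]. *)
Definition lo (c s : R) : R := c - s * (1 - c).
Definition hi (c s : R) : R := c + s * c.
Definition flip (c s t : R) : R := c - s * (t - c).

(** The two last inequalities make monotone the cubics that fill the gaps
    [[r, lo]] and [[hi, 1 - s ^ 2]]. *)
Record geometry (c s r : R) : Prop := {
  geo_c : 0 < c < 1;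
  geo_s : 0 < s < 1;
  geo_r : 0 < r < lo c s;
  geo_hi : hi c s < 1 - s ^ 2;
  geo_left : bez1 r (lo c s) (hi c s) (s / r)
             <= bez2 r (lo c s) (1 - s ^ 2) (r / s);
  geo_right : bez2 (hi c s) (1 - s ^ 2) r (- (r / s ^ 2))
              <= bez1 (hi c s) (1 - s ^ 2) (1 - s ^ 2 * (1 - lo c s))
                   (- (s ^ 2 / r)) }.

Lemma lo_hi c s r : geometry c s r -> 0 < r < lo c s /\ lo c s < c < hi c s /\
  hi c s < 1 - s ^ 2 < 1.
Proof. intros [Hc Hs Hr Hh _ _]. unfold lo, hi in *. repeat split; nra. Qed.

Lemma flip_range c s t : 0 < s -> I01 t -> lo c s <= flip c s t <= hi c s.
Proof. unfold I01, lo, hi, flip. intros. nra. Qed.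

Lemma flip_inverse c s x : 0 < s -> lo c s <= x <= hi c s ->
  I01 (c - (x - c) / s) /\ flip c s (c - (x - c) / s) = x.
Proof.
  unfold I01, lo, hi, flip. intros Hs Hx.
  assert (E : (x - c) / s * s = x - c) by (field; lra).
  set (q := (x - c) / s) in *. repeat split; nra.
Qed.

(** Every point of [[0, 1]] other than [c] leaves [[lo, hi]] after finitely
    many applications of the inverse of [flip], as these multiply its distance
    to [c] by [1 / s]. *)
Lemma selfsimilar_induction c s r (P : R -> Prop) :
  geometry c s r ->
  P c ->
  (forall x, I01 x -> x < lo c s \/ hi c s < x -> P x) ->
  (forall t, I01 t -> P t -> P (flip c s t)) ->
  forall x, I01 x -> P x.
Proof.
  intros G Pc Pout Pin.
  pose proof (geo_c _ _ _ G) as Hc. pose proof (geo_s _ _ _ G) as Hs.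
  assert (Hn : forall n x, I01 x -> s ^ n < Rabs (x - c) -> P x).
  { induction n as [|n IH]; intros x Hx Hd.
    - exfalso. unfold I01 in Hx. simpl in Hd.
      assert (Rabs (x - c) <= 1) by (apply Rabs_le; lra). lra.
    - destruct (Rlt_dec x (lo c s)) as [Hl|Hl]; [apply Pout; auto|].
      destruct (Rlt_dec (hi c s) x) as [Hr|Hr]; [apply Pout; auto|].
      destruct (flip_inverse c s x) as [Ht E]; [lra|lra|].
      rewrite <- E. apply Pin; [exact Ht|]. apply IH; [exact Ht|].
      replace (c - (x - c) / s - c) with (- ((x - c) * / s)) by (field; lra).
      rewrite Rabs_Ropp, Rabs_mult, Rabs_inv, (Rabs_pos_eq s) by lra.
      apply Rmult_lt_reg_r with s; [lra|].
      rewrite Rmult_assoc, Rinv_l, Rmult_1_r by lra. simpl in Hd. lra. }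
  intros x Hx. destruct (Req_dec x c) as [->|Hne]; [exact Pc|].
  assert (Hpos : 0 < Rabs (x - c)) by (apply Rabs_pos_lt; lra).
  destruct (pow_lt_1_zero s ltac:(rewrite Rabs_pos_eq; lra) _ Hpos) as [N HN].
  apply (Hn N x Hx). specialize (HN N (le_n N)).
  rewrite Rabs_pos_eq in HN; [exact HN|apply pow_le; lra].
Qed.

Definition rescale (c s : R) (j : jet) : jet :=
  Jet (fun x => 1 - s ^ 2 * (1 - val j (c - (x - c) / s)))
      (fun x => - s * der j (c - (x - c) / s)).

(** A map is a fixed point of the renormalization when it equals its image
    under [step]: the two lines make the return branch from [[1 - s ^ 2, 1]]
    to [[lo, hi]] affine, so that on [[lo, hi]] the map must be a rescaled copy
    of itself.  The slopes of the two cubics are those that make the pieces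
    fit to first order. *)
Definition left_cubic (c s r : R) : jet :=
  bezier r (lo c s) (hi c s) (s / r) (1 - s ^ 2) (r / s).
Definition right_cubic (c s r : R) : jet :=
  bezier (hi c s) (1 - s ^ 2) (1 - s ^ 2 * (1 - lo c s)) (- (s ^ 2 / r))
    r (- (r / s ^ 2)).

Definition step (c s r : R) (j : jet) : jet :=
  glue r (line (lo c s) (s / r) 0)
  (glue (lo c s) (left_cubic c s r)
  (glue (hi c s) (rescale c s j)
  (glue (1 - s ^ 2) (right_cubic c s r)
  (line 0 (- (r / s ^ 2)) 1)))).

Record admissible (c s r K : R) (j : jet) : Prop := {
  adm_taylor : taylor K 0 1 j;
  adm_0 : val j 0 = lo c s /\ der j 0 = s / r;
  adm_1 : val j 1 = 0 /\ der j 1 = - (r / s ^ 2);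
  adm_c : val j c = 1 /\ der j c = 0 }.

Definition start (c s r : R) : jet :=
  glue c (bezier 0 c (lo c s) (s / r) 1 0) (bezier c 1 1 0 0 (- (r / s ^ 2))).

(** Rescaling values by [s ^ 2] and lengths by [s] leaves the constant of a
    quadratic estimate unchanged; this is why the fixed point is [C^{1+Lip}]. *)
Lemma taylor_rescale c s K j : 0 < s -> taylor K 0 1 j ->
  taylor K (lo c s) (hi c s) (rescale c s j).
Proof.
  intros Hs Hj x y Hx Hy.
  destruct (flip_inverse c s x Hs Hx) as [Hx' _].
  destruct (flip_inverse c s y Hs Hy) as [Hy' _].
  specialize (Hj _ _ Hx' Hy'). simpl.
  assert (E : y - x = - s * (c - (y - c) / s - (c - (x - c) / s))) by (field; lra).
  rewrite E.
  set (x' := c - (x - c) / s) in *. set (y' := c - (y - c) / s) in *.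
  match goal with |- Rabs ?T <= _ =>
    replace T with (s ^ 2 * (val j y' - val j x' - der j x' * (y' - x'))) by ring
  end.
  rewrite Rabs_mult, (Rabs_pos_eq (s ^ 2)) by apply pow2_ge_0.
  pose proof (pow2_ge_0 s). nra.
Qed.

Ltac decide_glue :=
  repeat match goal with |- context [Rle_dec ?a ?b] =>
    destruct (Rle_dec a b); try (exfalso; lra) end.

Lemma step_outside c s r j k x : geometry c s r -> x < lo c s \/ hi c s < x ->
  val (step c s r j) x = val (step c s r k) x /\
  der (step c s r j) x = der (step c s r k) x.
Proof.
  intros G Hx. apply lo_hi in G. unfold step. cbn -[pow bezier line rescale].
  decide_glue; auto.
Qed.

Lemma step_left_line c s r j x : x <= r ->
  val (step c s r j) x = lo c s + s / r * x /\ der (step c s r j) x = s / r.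
Proof.
  intros Hx. unfold step. cbn -[pow left_cubic right_cubic rescale].
  decide_glue. split; ring.
Qed.

Lemma step_left_cubic c s r j x : geometry c s r -> r < x <= lo c s ->
  val (step c s r j) x = val (left_cubic c s r) x /\
  der (step c s r j) x = der (left_cubic c s r) x.
Proof.
  intros G Hx. unfold step. cbn -[pow left_cubic right_cubic rescale line].
  decide_glue. auto.
Qed.

Lemma step_right_cubic c s r j x : geometry c s r -> hi c s < x <= 1 - s ^ 2 ->
  val (step c s r j) x = val (right_cubic c s r) x /\
  der (step c s r j) x = der (right_cubic c s r) x.
Proof.
  intros G Hx. apply lo_hi in G.
  unfold step. cbn -[pow left_cubic right_cubic rescale line].
  decide_glue. auto.
Qed.

Lemma step_right_line c s r j x : geometry c s r -> 1 - s ^ 2 <= x ->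
  val (step c s r j) x = r / s ^ 2 * (1 - x) /\
  (1 - s ^ 2 < x -> der (step c s r j) x = - (r / s ^ 2)).
Proof.
  intros G Hx. pose proof (geo_s _ _ _ G). apply lo_hi in G.
  destruct (Req_dec x (1 - s ^ 2)) as [->|Hne].
  - split; [|lra]. unfold step. cbn -[pow left_cubic right_cubic rescale line].
    decide_glue. unfold right_cubic.
    match goal with |- val (bezier ?a ?b ?A ?p ?B ?q) _ = _ =>
      destruct (bezier_right a b A p B q) as [-> _]; [lra|] end.
    field. lra.
  - unfold step. cbn -[pow left_cubic right_cubic rescale].
    decide_glue. split; intros; ring.
Qed.

Lemma rescale_lo c s r K j : geometry c s r -> admissible c s r K j ->
  val (rescale c s j) (lo c s) = 1 - s ^ 2 /\ der (rescale c s j) (lo c s) = r / s.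
Proof.
  intros G [_ _ [V D] _]. pose proof (geo_s _ _ _ G). cbn -[pow].
  replace (c - (lo c s - c) / s) with 1 by (unfold lo; field; lra).
  rewrite V, D. split; [ring|field; lra].
Qed.

Lemma rescale_hi c s r K j : geometry c s r -> admissible c s r K j ->
  val (rescale c s j) (hi c s) = 1 - s ^ 2 * (1 - lo c s) /\
  der (rescale c s j) (hi c s) = - (s ^ 2 / r).
Proof.
  intros G [_ [V D] _ _]. pose proof (geo_s _ _ _ G). pose proof (geo_r _ _ _ G).
  cbn -[pow].
  replace (c - (hi c s - c) / s) with 0 by (unfold hi; field; lra).
  rewrite V, D. split; [ring|field; lra].
Qed.

Lemma step_inside c s r K j x :
  geometry c s r -> admissible c s r K j -> lo c s <= x <= hi c s ->
  val (step c s r j) x = val (rescale c s j) x /\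
  der (step c s r j) x = der (rescale c s j) x.
Proof.
  intros G A Hx.
  pose proof (lo_hi _ _ _ G) as H.
  destruct (Req_dec x (lo c s)) as [->|Hne].
  - destruct (step_left_cubic c s r j (lo c s) G) as [-> ->]; [lra|].
    destruct (rescale_lo _ _ _ _ _ G A) as [-> ->].
    apply bezier_right. lra.
  - unfold step. cbn -[pow left_cubic right_cubic rescale line].
    decide_glue. auto.
Qed.

Lemma start_admissible c s r : geometry c s r ->
  exists K, admissible c s r K (start c s r).
Proof.
  intros G. pose proof (geo_c _ _ _ G) as Hc. unfold start.
  destruct (taylor_bezier 0 c (lo c s) (s / r) 1 0) as [K1 T1]; [lra|].
  destruct (taylor_bezier c 1 1 0 0 (- (r / s ^ 2))) as [K2 T2]; [lra|].
  destruct (bezier_right 0 c (lo c s) (s / r) 1 0) as [R1 R2]; [lra|].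
  destruct (bezier_left c 1 1 0 0 (- (r / s ^ 2))) as [L1 L2]; [lra|].
  exists (Rmax K1 K2). split.
  - apply taylor_glue.
    + eapply taylor_weaken; [apply Rmax_l|exact T1].
    + eapply taylor_weaken; [apply Rmax_r|exact T2].
    + rewrite R1, L1. reflexivity.
    + rewrite R2, L2. reflexivity.
  - cbn -[pow bezier]. decide_glue. apply bezier_left. lra.
  - cbn -[pow bezier]. decide_glue. apply bezier_right. lra.
  - cbn -[pow bezier]. decide_glue. auto.
Qed.

Lemma step_admissible c s r K j :
  geometry c s r -> 0 <= K ->
  taylor K r (lo c s) (left_cubic c s r) ->
  taylor K (hi c s) (1 - s ^ 2) (right_cubic c s r) ->
  admissible c s r K j -> admissible c s r K (step c s r j).
Proof.
  intros G HK TL TR A.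
  pose proof (lo_hi _ _ _ G) as H. pose proof (geo_s _ _ _ G) as Hs.
  destruct (rescale_lo _ _ _ _ _ G A) as [VL DL].
  destruct (rescale_hi _ _ _ _ _ G A) as [VR DR].
  assert (BL := bezier_left r (lo c s) (hi c s) (s / r) (1 - s ^ 2) (r / s)).
  assert (BR := bezier_right r (lo c s) (hi c s) (s / r) (1 - s ^ 2) (r / s)).
  assert (CL := bezier_left (hi c s) (1 - s ^ 2) (1 - s ^ 2 * (1 - lo c s))
                  (- (s ^ 2 / r)) r (- (r / s ^ 2))).
  assert (CR := bezier_right (hi c s) (1 - s ^ 2) (1 - s ^ 2 * (1 - lo c s))
                  (- (s ^ 2 / r)) r (- (r / s ^ 2))).
  fold (left_cubic c s r) in BL, BR. fold (right_cubic c s r) in CL, CR.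
  destruct BL as [BL1 BL2]; [lra|]. destruct BR as [BR1 BR2]; [lra|].
  destruct CL as [CL1 CL2]; [lra|]. destruct CR as [CR1 CR2]; [lra|].
  split.
  - repeat apply taylor_glue; try (apply taylor_line; exact HK);
      try assumption; try (apply taylor_rescale; [lra|apply A]);
      cbn -[pow left_cubic right_cubic rescale]; decide_glue; try congruence.
    + rewrite CR1. field. lra.
    + rewrite BL1. unfold lo, hi. field. lra.
  - destruct (step_left_line c s r j 0) as [-> ->]; [lra|]. split; ring.
  - destruct (step_right_line c s r j 1 G) as [-> E]; [lra|].
    rewrite E by lra. split; ring.
  - destruct (step_inside _ _ _ _ _ c G A) as [-> ->]; [lra|].
    cbn -[pow]. replace (c - (c - c) / s) with c by (field; lra).
    destruct (adm_c _ _ _ _ _ A) as [-> ->]. split; ring.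
Qed.

(** The iterates of [step] are eventually constant at each point, so they have
    a pointwise limit, which inherits their common quadratic estimate. *)
Lemma fixed_jet_exists c s r : geometry c s r ->
  exists K j, 0 <= K /\ admissible c s r K j /\
    forall x, I01 x -> val j x = val (step c s r j) x /\
                       der j x = der (step c s r j) x.
Proof.
  intros G.
  pose proof (lo_hi _ _ _ G) as H. pose proof (geo_s _ _ _ G) as Hs.
  destruct (start_admissible c s r G) as [K0 A0].
  destruct (taylor_bezier r (lo c s) (hi c s) (s / r) (1 - s ^ 2) (r / s))
    as [K1 T1]; [lra|].
  destruct (taylor_bezier (hi c s) (1 - s ^ 2) (1 - s ^ 2 * (1 - lo c s))
              (- (s ^ 2 / r)) r (- (r / s ^ 2))) as [K2 T2]; [lra|].
  set (K := Rabs K0 + Rabs K1 + Rabs K2).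
  assert (HK : 0 <= K /\ K0 <= K /\ K1 <= K /\ K2 <= K).
  { pose proof (Rabs_pos K0). pose proof (Rabs_pos K1). pose proof (Rabs_pos K2).
    pose proof (Rle_abs K0). pose proof (Rle_abs K1). pose proof (Rle_abs K2).
    unfold K. lra. }
  destruct HK as (HK & HK0 & HK1 & HK2).
  set (F := fun n => Nat.iter n (step c s r) (start c s r)).
  assert (A : forall n, admissible c s r K (F n)).
  { induction n as [|n IH].
    - destruct A0 as [T ? ? ?]. split; auto. exact (taylor_weaken _ _ _ _ _ HK0 T).
    - apply step_admissible; auto.
      + exact (taylor_weaken _ _ _ _ _ HK1 T1).
      + exact (taylor_weaken _ _ _ _ _ HK2 T2). }
  assert (Hlim : forall x, exists p, I01 x -> exists N, forall n, (N <= n)%nat ->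
            val (F n) x = fst p /\ der (F n) x = snd p).
  { intros x. destruct (Rle_dec 0 x) as [H0|H0];
      [|exists (0, 0); unfold I01; intros; lra].
    destruct (Rle_dec x 1) as [H1|H1]; [|exists (0, 0); unfold I01; intros; lra].
    assert (Hx : I01 x) by (split; assumption).
    enough (exists p N, forall n, (N <= n)%nat ->
              val (F n) x = fst p /\ der (F n) x = snd p) as (p & N & E)
      by (exists p; intros _; exists N; exact E).
    revert x H0 H1 Hx. intros x _ _. revert x.
    apply (selfsimilar_induction c s r); [exact G| | |].
    - exists (1, 0), 0%nat. intros n _. apply A.
    - intros x _ Hout.
      exists (val (F 1%nat) x, der (F 1%nat) x), 1%nat. intros [|n] Hn; [lia|].
      exact (step_outside c s r (F n) (F 0%nat) x G Hout).
    - intros t Ht (p & N & E).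
      exists (1 - s ^ 2 * (1 - fst p), - s * snd p), (S N). intros [|n] Hn; [lia|].
      destruct (E n) as [E1 E2]; [lia|].
      change (F (S n)) with (step c s r (F n)).
      destruct (step_inside c s r K (F n) (flip c s t) G (A n)) as [-> ->].
      { apply flip_range; [lra|exact Ht]. }
      cbn -[pow]. replace (c - (flip c s t - c) / s) with t
        by (unfold flip; field; lra).
      rewrite E1, E2. split; reflexivity. }
  destruct (functional_choice _ Hlim) as [p Hp].
  set (j := Jet (fun x => fst (p x)) (fun x => snd (p x))).
  assert (Hj : forall x, I01 x -> exists N, forall n, (N <= n)%nat ->
            val (F n) x = val j x /\ der (F n) x = der j x) by exact Hp.
  assert (Aj : admissible c s r K j).
  { assert (Hval : forall x, I01 x -> exists n, val (F n) x = val j x /\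
              der (F n) x = der j x).
    { intros x Hx. destruct (Hj x Hx) as [N E]. exists N. apply E. lia. }
    split.
    - intros x y Hx Hy.
      destruct (Hj x Hx) as [N E]. destruct (Hj y Hy) as [M E'].
      destruct (E (N + M)%nat) as [E1 E2]; [lia|].
      destruct (E' (N + M)%nat) as [E3 _]; [lia|].
      rewrite <- E1, <- E2, <- E3. apply A; assumption.
    - destruct (Hval 0) as (n & <- & <-); [unfold I01; lra|]. apply A.
    - destruct (Hval 1) as (n & <- & <-); [unfold I01; lra|]. apply A.
    - destruct (Hval c) as (n & <- & <-); [unfold I01; lra|]. apply A. }
  exists K, j. split; [exact HK|]. split; [exact Aj|].
  intros x Hx. destruct (Hj x Hx) as [N E].
  assert (Hcase : (x < lo c s \/ hi c s < x) \/ lo c s <= x <= hi c s) by lra.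
  destruct Hcase as [Hout|Hin].
  - destruct (E (S N)) as [<- <-]; [lia|]. apply step_outside; assumption.
  - destruct (flip_inverse c s x) as [Ht _]; [lra|exact Hin|].
    destruct (Hj _ Ht) as [M E'].
    destruct (E (S (N + M))) as [<- <-]; [lia|].
    change (F (S (N + M))) with (step c s r (F (N + M)%nat)).
    destruct (step_inside _ _ _ _ _ x G (A (N + M)%nat) Hin) as [-> ->].
    destruct (step_inside _ _ _ _ _ x G Aj Hin) as [-> ->].
    cbn -[pow F]. destruct (E' (N + M)%nat) as [-> ->]; [lia|]. auto.
Qed.
(** * Consequences of self-similarity *)

(** The values of a fixed point of the renormalization, restricted to what the
    combinatorics and the affine pieces depend on.  Only points of [[0, 1]]
    are involved, so the property is shared by the iterates of [renorm]. *)
Record selfsimilar (c s r : R) (g : R -> R) : Prop := {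
  ss_I01 : forall x, I01 x -> I01 (g x);
  ss_left : forall x, 0 <= x <= r -> g x = lo c s + s / r * x;
  ss_right : forall x, 1 - s ^ 2 <= x <= 1 -> g x = r / s ^ 2 * (1 - x);
  ss_flip : forall t, I01 t -> g (flip c s t) = 1 - s ^ 2 * (1 - g t) }.

Lemma flip_I01 c s r t : geometry c s r -> I01 t -> I01 (flip c s t).
Proof.
  intros G Ht. pose proof (geo_s _ _ _ G). apply lo_hi in G.
  assert (lo c s <= flip c s t <= hi c s) by (apply flip_range; [lra|exact Ht]).
  unfold I01. lra.
Qed.

Lemma selfsimilar_ext c s r f g : geometry c s r ->
  (forall x, I01 x -> g x = f x) -> selfsimilar c s r f -> selfsimilar c s r g.
Proof.
  intros G E [S0 Sl Sr Sf]. pose proof (lo_hi _ _ _ G). split.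
  - intros x Hx. rewrite E; auto.
  - intros x Hx. rewrite E; auto. unfold I01; lra.
  - intros x Hx. rewrite E; auto. unfold I01; lra.
  - intros t Ht. rewrite !E; auto. apply (flip_I01 c s r); auto.
Qed.

Lemma fixed_selfsimilar c s r K j : geometry c s r -> admissible c s r K j ->
  (forall x, I01 x -> val j x = val (step c s r j) x /\
                      der j x = der (step c s r j) x) ->
  selfsimilar c s r (val j).
Proof.
  intros G A Hfix.
  pose proof (lo_hi _ _ _ G) as H. pose proof (geo_s _ _ _ G) as Hs.
  assert (Sl : forall x, 0 <= x <= r -> val j x = lo c s + s / r * x).
  { intros x Hx. destruct (Hfix x) as [-> _]; [unfold I01; lra|].
    apply step_left_line. lra. }
  assert (Sr : forall x, 1 - s ^ 2 <= x <= 1 -> val j x = r / s ^ 2 * (1 - x)).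
  { intros x Hx. destruct (Hfix x) as [-> _]; [unfold I01; lra|].
    apply step_right_line; [exact G|lra]. }
  assert (Sf : forall t, I01 t -> val j (flip c s t) = 1 - s ^ 2 * (1 - val j t)).
  { intros t Ht.
    destruct (Hfix (flip c s t)) as [-> _]; [apply (flip_I01 c s r); auto|].
    destruct (step_inside _ _ _ _ _ (flip c s t) G A) as [-> _];
      [apply flip_range; [lra|exact Ht]|].
    cbn -[pow]. do 4 f_equal. unfold flip. field. lra. }
  split; auto.
  assert (Hsr : 0 < s / r) by (apply Rdiv_lt_0_compat; lra).
  assert (Hrs : 0 < r / s) by (apply Rdiv_lt_0_compat; lra).
  assert (Hs2 : 0 < s ^ 2) by nra.
  assert (Hrs2 : 0 < r / s ^ 2) by (apply Rdiv_lt_0_compat; lra).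
  assert (Hs2r : 0 < s ^ 2 / r) by (apply Rdiv_lt_0_compat; lra).
  apply (selfsimilar_induction c s r); [exact G| | |].
  - rewrite (proj1 (adm_c _ _ _ _ _ A)). unfold I01. lra.
  - intros x Hx Hout.
    assert (Hcase : 0 <= x <= r \/ r < x <= lo c s \/ hi c s < x <= 1 - s ^ 2
                    \/ 1 - s ^ 2 <= x <= 1) by (unfold I01 in Hx; lra).
    destruct Hcase as [Hc|[Hc|[Hc|Hc]]].
    + rewrite Sl by exact Hc.
      assert (E : s / r * r = s) by (field; lra).
      assert (E' : hi c s = lo c s + s) by (unfold hi, lo; ring).
      unfold I01. nra.
    + rewrite (proj1 (Hfix x Hx)).
      destruct (step_left_cubic c s r j x G Hc) as [-> _].
      pose proof (geo_left _ _ _ G) as Hg.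
      assert (hi c s <= bez1 r (lo c s) (hi c s) (s / r)) by (unfold bez1; nra).
      assert (bez2 r (lo c s) (1 - s ^ 2) (r / s) <= 1 - s ^ 2)
        by (unfold bez2; nra).
      apply bezier_I01; unfold I01; lra.
    + rewrite (proj1 (Hfix x Hx)).
      destruct (step_right_cubic c s r j x G Hc) as [-> _].
      pose proof (geo_right _ _ _ G) as Hg.
      set (A1 := 1 - s ^ 2 * (1 - lo c s)) in *.
      assert (0 <= A1 <= 1) by (unfold A1; nra).
      assert (bez1 (hi c s) (1 - s ^ 2) A1 (- (s ^ 2 / r)) <= A1)
        by (unfold bez1; nra).
      assert (r <= bez2 (hi c s) (1 - s ^ 2) r (- (r / s ^ 2)))
        by (unfold bez2; nra).
      apply bezier_I01; fold A1; unfold I01; lra.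
    + rewrite Sr by exact Hc.
      assert (E : r / s ^ 2 * s ^ 2 = r) by (field; lra).
      unfold I01. nra.
  - intros t Ht IH. rewrite Sf by exact Ht. unfold I01 in *. nra.
Qed.

Lemma fixed_critical c s r K j : geometry c s r -> admissible c s r K j ->
  (forall x, I01 x -> val j x = val (step c s r j) x /\
                      der j x = der (step c s r j) x) ->
  forall x, I01 x -> (der j x = 0 <-> x = c).
Proof.
  intros G A Hfix.
  pose proof (lo_hi _ _ _ G) as H. pose proof (geo_s _ _ _ G) as Hs.
  pose proof (geo_c _ _ _ G) as Hc.
  assert (Hne : forall x, I01 x -> x <> c -> der j x <> 0).
  { apply (selfsimilar_induction c s r (fun x => x <> c -> der j x <> 0) G).
    - congruence.
    - intros x Hx Hout _. rewrite (proj2 (Hfix x Hx)).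
      assert (Hsr : 0 < s / r) by (apply Rdiv_lt_0_compat; lra).
      assert (Hrs : 0 < r / s) by (apply Rdiv_lt_0_compat; lra).
      assert (Hs2 : 0 < s ^ 2) by nra.
      assert (Hrs2 : 0 < r / s ^ 2) by (apply Rdiv_lt_0_compat; lra).
      assert (Hs2r : 0 < s ^ 2 / r) by (apply Rdiv_lt_0_compat; lra).
      assert (Hcase : x <= r \/ r < x <= lo c s \/ hi c s < x <= 1 - s ^ 2
                      \/ 1 - s ^ 2 < x) by (unfold I01 in Hx; lra).
      destruct Hcase as [Hx'|[Hx'|[Hx'|Hx']]].
      + destruct (step_left_line c s r j x Hx') as [_ ->]. lra.
      + destruct (step_left_cubic c s r j x G Hx') as [_ ->].
        apply Rgt_not_eq, bezier_increasing; try lra. apply G.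
      + destruct (step_right_cubic c s r j x G Hx') as [_ ->].
        apply Rlt_not_eq, bezier_decreasing; try lra. apply G.
      + destruct (step_right_line c s r j x G) as [_ ->]; lra.
    - intros t Ht IH Hx.
      rewrite (proj2 (Hfix _ (flip_I01 c s r t G Ht))).
      destruct (step_inside _ _ _ _ _ (flip c s t) G A) as [_ ->];
        [apply flip_range; [lra|exact Ht]|].
      cbn -[pow]. replace (c - (flip c s t - c) / s) with t
        by (unfold flip; field; lra).
      assert (t <> c) by (intros ->; apply Hx; unfold flip; ring).
      specialize (IH H0). apply Rmult_integral_contrapositive. split; lra. }
  intros x Hx. split.
  - intros Hd. destruct (Req_dec x c) as [E|E]; [exact E|].
    exfalso. exact (Hne x Hx E Hd).
  - intros ->. apply A.
Qed.

Lemma jet_unimodal K j c g :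
  0 <= K -> taylor K 0 1 j -> (forall x, I01 x -> g x = val j x) ->
  (forall x, I01 x -> I01 (g x)) -> I01 c ->
  (forall x, I01 x -> (der j x = 0 <-> x = c)) -> g c = 1 -> g 1 = 0 ->
  unimodal g c.
Proof.
  intros HK T E Hmap Hc Hcrit H1 H0.
  assert (T' : taylor K 0 1 (Jet g (der j))).
  { intros x y Hx Hy. simpl. rewrite !E; [apply T| |]; assumption. }
  split; [exact Hmap|]. split; [|auto].
  exists (der j). split; [|split; [|auto]].
  - intros x Hx. exact (taylor_D_in K _ x HK T' Hx).
  - apply lipschitz_continue_in with (2 * K); [lra|].
    exact (taylor_lipschitz _ _ _ _ T).
Qed.

Lemma selfsimilar_orbit c s r g : geometry c s r -> selfsimilar c s r g ->
  g c = 1 /\ g 1 = 0 /\ g 0 = lo c s /\ g (lo c s) = 1 - s ^ 2 /\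
  g (1 - s ^ 2) = r /\ g r = hi c s.
Proof.
  intros G S. pose proof (lo_hi _ _ _ G) as H.
  pose proof (geo_s _ _ _ G) as Hs. pose proof (geo_c _ _ _ G) as Hc.
  assert (g1 : g 1 = 0) by (rewrite (ss_right _ _ _ _ S) by lra; ring).
  repeat split.
  - (* [c] is the fixed point of [flip], so [1 - g c = s ^ 2 * (1 - g c)]. *)
    assert (E := ss_flip _ _ _ _ S c ltac:(unfold I01; lra)).
    replace (flip c s c) with c in E by (unfold flip; ring). nra.
  - exact g1.
  - rewrite (ss_left _ _ _ _ S) by lra. ring.
  - assert (E := ss_flip _ _ _ _ S 1 ltac:(unfold I01; lra)).
    rewrite g1 in E. replace (flip c s 1) with (lo c s) in E by (unfold flip, lo; ring).
    lra.
  - rewrite (ss_right _ _ _ _ S) by lra. field. lra.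
  - rewrite (ss_left _ _ _ _ S) by lra. unfold lo, hi. field. lra.
Qed.

Lemma selfsimilar_iter4 c s r g : geometry c s r -> selfsimilar c s r g ->
  Nat.iter 4 g 0 = hi c s.
Proof.
  intros G S. destruct (selfsimilar_orbit c s r g G S) as (_ & _ & E0 & E1 & E2 & E3).
  cbn [Nat.iter nat_rect]. rewrite E0, E1, E2. exact E3.
Qed.

Lemma selfsimilar_h c s r g t : geometry c s r -> selfsimilar c s r g ->
  h g t = flip c s t.
Proof.
  intros G S. unfold h. rewrite (selfsimilar_iter4 c s r g G S).
  destruct (selfsimilar_orbit c s r g G S) as (_ & _ & -> & _).
  unfold flip, lo, hi. ring.
Qed.

(** On [[lo, hi]] the third iterate is the self-similar branch followed by two
    affine ones, and these undo the contraction by [s ^ 2]. *)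
Lemma selfsimilar_iter3 c s r g t : geometry c s r -> selfsimilar c s r g ->
  I01 t -> Nat.iter 3 g (flip c s t) = flip c s (g t).
Proof.
  intros G S Ht. pose proof (lo_hi _ _ _ G) as H. pose proof (geo_s _ _ _ G) as Hs.
  pose proof (ss_I01 _ _ _ _ S t Ht) as Hg. unfold I01 in Hg.
  cbn [Nat.iter nat_rect]. rewrite (ss_flip _ _ _ _ S t Ht).
  rewrite (ss_right _ _ _ _ S (1 - s ^ 2 * (1 - g t))) by nra.
  replace (r / s ^ 2 * (1 - (1 - s ^ 2 * (1 - g t)))) with (r * (1 - g t))
    by (field; lra).
  rewrite (ss_left _ _ _ _ S) by nra. unfold flip, lo. field. lra.
Qed.

Lemma selfsimilar_renorm c s r g x : geometry c s r -> selfsimilar c s r g ->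
  I01 x -> renorm g x = g x.
Proof.
  intros G S Hx. pose proof (lo_hi _ _ _ G) as H. pose proof (geo_s _ _ _ G) as Hs.
  unfold renorm, h_inv.
  rewrite (selfsimilar_h c s r g x G S), (selfsimilar_iter3 c s r g x G S Hx).
  rewrite (selfsimilar_iter4 c s r g G S).
  destruct (selfsimilar_orbit c s r g G S) as (_ & _ & -> & _).
  unfold flip, hi, lo. field. lra.
Qed.

Lemma selfsimilar_renorm_iter c s r f n : geometry c s r -> selfsimilar c s r f ->
  forall x, I01 x -> Nat.iter n renorm f x = f x.
Proof.
  intros G S. induction n as [|n IH]; intros x Hx; [reflexivity|].
  change (Nat.iter (Datatypes.S n) renorm f x)
    with (renorm (Nat.iter n renorm f) x).
  rewrite (selfsimilar_renorm c s r); auto.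
  exact (selfsimilar_ext _ _ _ _ _ G IH S).
Qed.

Lemma interior_between (A : R -> Prop) a b x :
  (forall y, A y -> a <= y <= b) -> interior A x -> a < x < b.
Proof.
  intros HA [d Hd]. pose proof (cond_pos d) as Hp.
  assert (Hl : A (x - d / 2)).
  { apply Hd. unfold disc. rewrite Rabs_left1; lra. }
  assert (Hr : A (x + d / 2)).
  { apply Hd. unfold disc. rewrite Rabs_pos_eq; lra. }
  apply HA in Hl, Hr. lra.
Qed.

Lemma disjoint_interiors_ordered (A B : R -> Prop) a b d e : b <= d ->
  (forall y, A y -> a <= y <= b) -> (forall y, B y -> d <= y <= e) ->
  disjoint_interiors A B.
Proof.
  intros Hbd HA HB x [Ha Hb].
  apply (interior_between A a b) in Ha; [|exact HA].
  apply (interior_between B d e) in Hb; [|exact HB]. lra.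
Qed.

Lemma selfsimilar_renormalizable c s r g : geometry c s r ->
  selfsimilar c s r g -> unimodal g c -> renormalizable g c.
Proof.
  intros G S U. pose proof (lo_hi _ _ _ G) as H. pose proof (geo_s _ _ _ G) as Hs.
  pose proof (geo_c _ _ _ G) as Hc.
  pose proof (selfsimilar_iter4 c s r g G S) as E4.
  destruct (selfsimilar_orbit c s r g G S) as (_ & _ & E0 & _).
  assert (HJ : forall x, J g x <-> lo c s <= x <= hi c s)
    by (intros x; unfold J; rewrite E4, E0; reflexivity).
  assert (HJt : forall x, J g x -> exists t, I01 t /\ flip c s t = x).
  { intros x Hx. apply HJ in Hx.
    exists (c - (x - c) / s). apply flip_inverse; [lra|exact Hx]. }
  assert (HJ1 : forall y, image_dir g (J g) y -> 1 - s ^ 2 <= y <= 1).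
  { intros y (x & -> & Hx). destruct (HJt x Hx) as (t & Ht & <-).
    rewrite (ss_flip _ _ _ _ S t Ht).
    pose proof (ss_I01 _ _ _ _ S t Ht) as Hg. unfold I01 in Hg. nra. }
  assert (HJ2 : forall y, image_dir (Nat.iter 2 g) (J g) y -> 0 <= y <= r).
  { intros y (x & -> & Hx).
    assert (Hy : 1 - s ^ 2 <= g x <= 1) by (apply HJ1; exists x; auto).
    cbn [Nat.iter nat_rect]. rewrite (ss_right _ _ _ _ S) by exact Hy.
    assert (E : r / s ^ 2 * s ^ 2 = r) by (field; lra).
    assert (0 < r / s ^ 2) by (apply Rdiv_lt_0_compat; nra). nra. }
  split; [exact U|]. split; [rewrite E4, E0; lra|].
  split; [intros x Hx; apply HJ in Hx; unfold I01; lra|].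
  split; [exists 1; split; [unfold I01; lra|rewrite HJ; lra]|].
  split.
  - cbv zeta. repeat split.
    + apply (disjoint_interiors_ordered _ _ 0 r (lo c s) (hi c s));
        [lra|exact HJ2|intros y; apply HJ].
    + apply (disjoint_interiors_ordered _ _ (lo c s) (hi c s) (1 - s ^ 2) 1);
        [lra|intros y; apply HJ|exact HJ1].
    + apply (disjoint_interiors_ordered _ _ 0 r (1 - s ^ 2) 1);
        [lra|exact HJ2|exact HJ1].
    + intros a b Ha Hb. apply HJ2 in Ha. apply HJ in Hb. lra.
    + intros a b Ha Hb. apply HJ in Ha. apply HJ1 in Hb. lra.
  - intros y (x & -> & Hx). destruct (HJt x Hx) as (t & Ht & <-).
    rewrite (selfsimilar_iter3 c s r g t G S Ht). apply HJ.
    apply flip_range; [lra|]. apply S. exact Ht.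
Qed.

Lemma selfsimilar_length_J c s r f : geometry c s r -> selfsimilar c s r f ->
  Un_cv (length_J f) 0.
Proof.
  intros G S. pose proof (geo_s _ _ _ G) as Hs.
  assert (E : forall n t, h_comp f n t = c + (- s) ^ n * (t - c)).
  { induction n as [|n IH]; intros t; simpl; [ring|].
    rewrite IH, (selfsimilar_h c s r).
    - unfold flip. ring.
    - exact G.
    - apply (selfsimilar_ext _ _ _ f); auto.
      apply (selfsimilar_renorm_iter c s r); auto. }
  intros eps Heps.
  destruct (pow_lt_1_zero (- s)) with (y := eps) as [N HN].
  { rewrite Rabs_left1; lra. }
  { lra. }
  exists N. intros n Hn. unfold Rdist, length_J. rewrite !E, Rminus_0_r, Rabs_Rabsolu.
  replace (c + (- s) ^ n * (1 - c) - (c + (- s) ^ n * (0 - c))) with ((- s) ^ n)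
    by ring.
  apply HN. exact Hn.
Qed.

(** Along the orbit of [0] under [flip], which converges to [c], the quotient
    in the definition of the tip is constant: [1 - f] is multiplied by [s ^ 2]
    when the distance to [c] is multiplied by [s]. *)
Lemma selfsimilar_quadratic_tip c s r f : geometry c s r -> selfsimilar c s r f ->
  quadratic_tip f c.
Proof.
  intros G S. pose proof (lo_hi _ _ _ G) as H. pose proof (geo_s _ _ _ G) as Hs.
  pose proof (geo_c _ _ _ G) as Hc.
  destruct (selfsimilar_orbit c s r f G S) as (Ec & _ & E0 & _).
  set (y := fun n => c + (- s) ^ n * (0 - c)).
  assert (Hy : forall n, I01 (y n) /\ f (y n) = 1 - (s ^ n) ^ 2 * (1 - lo c s)).
  { induction n as [|n [IH1 IH2]].
    - unfold y. replace (c + (- s) ^ 0 * (0 - c)) with 0 by ring.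
      split; [unfold I01; lra|]. rewrite E0. ring.
    - assert (E : y (Datatypes.S n) = flip c s (y n)) by (unfold y, flip; simpl; ring).
      rewrite E. split; [apply (flip_I01 c s r); auto|].
      rewrite (ss_flip _ _ _ _ S _ IH1), IH2. simpl. ring. }
  assert (Hpow : forall n, (- s) ^ n <> 0) by (intros n; apply pow_nonzero; lra).
  exists y, ((1 - lo c s) / c ^ 2). repeat split.
  - apply Rdiv_lt_0_compat; nra.
  - apply Hy.
  - apply Hy.
  - unfold y. intros E. apply (Rmult_integral_contrapositive ((- s) ^ n) (0 - c)); [|lra].
    split; [apply Hpow|lra].
  - intros eps Heps.
    destruct (pow_lt_1_zero (- s)) with (y := eps) as [N HN].
    { rewrite Rabs_left1; lra. }
    { lra. }
    exists N. intros n Hn. unfold Rdist, y.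
    replace (c + (- s) ^ n * (0 - c) - c) with ((- s) ^ n * (- c)) by ring.
    rewrite Rabs_mult, (Rabs_left1 (- c)) by lra.
    specialize (HN n Hn). pose proof (Rabs_pos ((- s) ^ n)). nra.
  - intros eps Heps. exists 0%nat. intros n _.
    destruct (Hy n) as [_ ->]. rewrite Ec.
    assert (E : (s ^ n) ^ 2 = ((- s) ^ n) ^ 2)
      by (rewrite <- !pow_mult, !(Nat.mul_comm n), !pow_mult; f_equal; ring).
    specialize (Hpow n). unfold y. rewrite E.
    set (p := (- s) ^ n) in *.
    replace (c + p * (0 - c) - c) with (- (p * c)) by ring.
    match goal with |- Rdist ?a ?b < _ =>
      replace a with b by (field; split; [lra|exact Hpow]) end.
    rewrite Rdist_eq. lra.
Qed.

Definition orbit (c s r : R) : Prop :=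
  uk c 1 = lo c s /\ uk c 2 = 1 - s ^ 2 /\ uk c 3 = r /\ uk c 4 = hi c s.

(** Both [g] and [u c] have [1 - f] multiplied by [s ^ 2] under [flip], so that
    agreement at two end points is transported by [flip], and so is affinity. *)
Lemma affine_agreeing_flip c s r g sigma :
  geometry c s r -> selfsimilar c s r g ->
  (forall t, I01 t -> I01 (sigma t)) ->
  affine_agreeing c g sigma ->
  affine_agreeing c g (fun t => flip c s (sigma t)).
Proof.
  intros G S Hsig [(a & b & Hab) [A0 A1]].
  pose proof (geo_s _ _ _ G) as Hs. pose proof (geo_c _ _ _ G) as Hc.
  assert (Hu : forall x, u c (flip c s x) = 1 - s ^ 2 * (1 - u c x))
    by (intros x; unfold u, flip; field; lra).
  repeat split.
  - exists (- s * a), (1 - s ^ 2 * (1 - b) + s ^ 2 * a * (c + c / s)).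
    intros x (t & -> & Ht). rewrite (ss_flip _ _ _ _ S) by auto.
    rewrite (Hab (sigma t)) by (exists t; auto). unfold flip. field. lra.
  - rewrite (ss_flip _ _ _ _ S), Hu, A0; [reflexivity|].
    apply Hsig. unfold I01. lra.
  - rewrite (ss_flip _ _ _ _ S), Hu, A1; [reflexivity|].
    apply Hsig. unfold I01. lra.
Qed.

Lemma affine_agreeing_flip_iter c s r g sigma n :
  geometry c s r -> selfsimilar c s r g ->
  (forall t, st2 c t = flip c s t) ->
  (forall t, I01 t -> I01 (sigma t)) ->
  affine_agreeing c g sigma ->
  affine_agreeing c g (fun t => Nat.iter n (st2 c) (sigma t)).
Proof.
  intros G S Hst Hsig A.
  enough ((forall t, I01 t -> I01 (Nat.iter n (st2 c) (sigma t))) /\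
          affine_agreeing c g (fun t => Nat.iter n (st2 c) (sigma t))) by tauto.
  induction n as [|n [IH1 IH2]]; [split; assumption|].
  destruct (affine_agreeing_flip c s r g _ G S IH1 IH2) as [[a [b Hab]] [A0 A1]].
  split; [|split; [exists a, b|]].
  - intros t Ht. rewrite Nat.iter_succ, Hst. apply (flip_I01 c s r); auto.
  - intros x (t & -> & Ht). rewrite Nat.iter_succ, Hst. apply Hab. exists t; auto.
  - rewrite !Nat.iter_succ, !Hst. auto.
Qed.

Lemma selfsimilar_extends c s r g :
  geometry c s r -> selfsimilar c s r g -> orbit c s r -> extends_f_s c g.
Proof.
  intros G S (U1 & U2 & U3 & U4) n.
  pose proof (lo_hi _ _ _ G) as H. pose proof (geo_s _ _ _ G) as Hs.
  pose proof (geo_c _ _ _ G) as Hc.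
  destruct (selfsimilar_orbit c s r g G S) as (_ & E1 & E0 & _ & E2 & E3).
  assert (Hst : forall t, st2 c t = flip c s t)
    by (intros t; unfold st2, s2, flip; rewrite U1, U4; unfold lo, hi; ring).
  assert (H1 : forall t, st1 c t = r * (1 - t))
    by (intros t; unfold st1, s1; rewrite U3; reflexivity).
  assert (H3 : forall t, st3 c t = 1 - s ^ 2 * (1 - t))
    by (intros t; unfold st3, s3; rewrite U2; ring).
  split; apply (affine_agreeing_flip_iter c s r g); auto.
  - intros t Ht. rewrite H1. unfold I01 in *. nra.
  - repeat split.
    + exists (s / r), (lo c s). intros x (t & -> & Ht). rewrite H1.
      unfold I01 in Ht. rewrite (ss_left _ _ _ _ S) by nra. ring.
    + rewrite H1. replace (r * (1 - 0)) with r by ring.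
      rewrite E3, <- U4, <- U3. reflexivity.
    + rewrite H1. replace (r * (1 - 1)) with 0 by ring.
      rewrite E0, <- U1. reflexivity.
  - intros t Ht. rewrite H3. unfold I01 in *. nra.
  - repeat split.
    + exists (- (r / s ^ 2)), (r / s ^ 2). intros x (t & -> & Ht). rewrite H3.
      unfold I01 in Ht. rewrite (ss_right _ _ _ _ S) by nra. ring.
    + rewrite H3. replace (1 - s ^ 2 * (1 - 0)) with (1 - s ^ 2) by ring.
      rewrite E2, <- U2, <- U3. reflexivity.
    + rewrite H3. replace (1 - s ^ 2 * (1 - 1)) with 1 by ring.
      rewrite E1. unfold u. field. lra.
Qed.

(** The map exists whenever the inequalities of [geometry] hold; the orbit of
    [0] under [u c] is what makes its affine pieces agree with [u c]. *)
Lemma renormalization_fixed_point c s r : geometry c s r -> orbit c s r ->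
  exists F : R -> R,
    unimodal F c /\ C1Lip F /\ quadratic_tip F c /\
    infinitely_renormalizable F /\ extends_f_s c F /\
    (forall x, I01 x -> renorm F x = F x).
Proof.
  intros G O.
  destruct (fixed_jet_exists c s r G) as (K & j & HK & A & Hfix).
  pose proof (fixed_selfsimilar _ _ _ _ _ G A Hfix) as S.
  assert (U : forall g, (forall x, I01 x -> g x = val j x) -> unimodal g c).
  { intros g E. pose proof (selfsimilar_ext _ _ _ _ _ G E S) as Sg.
    destruct (selfsimilar_orbit c s r g G Sg) as (E1 & E0 & _).
    apply (jet_unimodal K j); auto.
    - apply A.
    - apply Sg.
    - pose proof (geo_c _ _ _ G). unfold I01. lra.
    - exact (fixed_critical _ _ _ _ _ G A Hfix). }
  exists (val j).
  split; [apply U; auto|].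
  split.
  { exists (der j), (2 * K). split.
    - intros x Hx. apply (taylor_D_in K); auto. apply A.
    - exact (taylor_lipschitz _ _ _ _ (adm_taylor _ _ _ _ _ A)). }
  split; [exact (selfsimilar_quadratic_tip c s r _ G S)|].
  split.
  { split; [|exact (selfsimilar_length_J c s r _ G S)].
    intros n. exists c.
    pose proof (selfsimilar_renorm_iter c s r _ n G S) as E.
    apply (selfsimilar_renormalizable c s r); auto.
    exact (selfsimilar_ext _ _ _ _ _ G E S). }
  split; [exact (selfsimilar_extends c s r _ G S O)|].
  intros x Hx. exact (selfsimilar_renorm c s r _ x G S Hx).
Qed.
(** * The parameter *)

(** With [a = 1 / (1 - c)] the map [u c] is affinely conjugate to
    [z |-> 1 - a z^2], and [0] to [1 - a].  Below, [- scale a] and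
    [height a - (a - 1)] are the images of [u c 0] and [u_c^3 (0)] in the
    coordinate [z]. *)
Definition scale (a : R) : R := a * (a - 1) ^ 2 - 1.
Definition height (a : R) : R := a ^ 2 * scale a ^ 2 * (2 - a * scale a ^ 2).

(** The difference between [u_c^4 (0)] and the value [hi] which it must have
    for [flip] to fix [c] (see [critical_orbit]). *)
Definition balance (a : R) : R := height a * (2 * (a - 1) - height a) - scale a.

Lemma critical_orbit c a : 0 < a -> c = 1 - / a ->
  uk c 1 = lo c (scale a) /\ uk c 2 = 1 - scale a ^ 2 /\ uk c 3 = height a / a /\
  uk c 4 = hi c (scale a) + balance a.
Proof.
  intros Ha ->.
  assert (E : forall x, u (1 - / a) x = 1 - (a * x - (a - 1)) ^ 2)
    by (intros x; unfold u; field; lra).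
  assert (E1 : uk (1 - / a) 1 = lo (1 - / a) (scale a)).
  { unfold uk; simpl Nat.iter. rewrite E. unfold lo, scale. field. lra. }
  assert (E2 : uk (1 - / a) 2 = 1 - scale a ^ 2).
  { change (uk (1 - / a) 2) with (u (1 - / a) (uk (1 - / a) 1)).
    rewrite E1, E. unfold lo. field. lra. }
  assert (E3 : uk (1 - / a) 3 = height a / a).
  { change (uk (1 - / a) 3) with (u (1 - / a) (uk (1 - / a) 2)).
    rewrite E2, E. unfold height. field. lra. }
  repeat split; auto.
  change (uk (1 - / a) 4) with (u (1 - / a) (uk (1 - / a) 3)).
  rewrite E3, E. unfold hi, balance.
  assert (Es : (a - 1) ^ 2 = (1 + scale a) / a) by (unfold scale; field; lra).
  replace (a * (height a / a) - (a - 1)) with (height a - (a - 1)) by (field; lra).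
  replace ((height a - (a - 1)) ^ 2)
    with (height a ^ 2 - 2 * (a - 1) * height a + (a - 1) ^ 2) by ring.
  rewrite Es. field. lra.
Qed.

(** Once the factor [scale a] is divided out, [balance a = 0] reads
    [v * (2 * (a - 1) - scale a * v) = 1] with [v = reduced a]; without this
    the superstable orbit of period 3, where [scale a = 0], would be a second
    solution. *)
Definition reduced (a : R) : R := a ^ 2 * scale a * (2 - a * scale a ^ 2).

Lemma balance_reduced a : 0 < scale a -> balance a = 0 ->
  reduced a * (2 * (a - 1) - scale a * reduced a) = 1.
Proof.
  intros Hs Hb.
  assert (E : height a = scale a * reduced a) by (unfold height, reduced; ring).
  unfold balance in Hb. rewrite E in Hb.
  apply Rmult_eq_reg_l with (scale a); lra.
Qed.

(** The order of the orbit confines [a] in two steps: [u_c (0) > u_c^3 (0)]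
    gives a crude bound on [reduced a], which the equation then sharpens. *)
Lemma c_star_range c : c_star_eq c ->
  let a := / (1 - c) in
  c = 1 - / a /\ 7 / 4 < a < 9 / 5 /\ 0 < scale a < 19 / 125 /\
  0 < reduced a < 21 / 25 /\
  reduced a * (2 * (a - 1) - scale a * reduced a) = 1.
Proof.
  intros [(Hc & H3 & H41 & H2 & H13 & H24) Heq] a.
  assert (Ha1 : a * (1 - c) = 1) by (unfold a; field; lra).
  assert (Ha : 1 < a < 2) by nra.
  assert (Ec : c = 1 - / a) by (unfold a; rewrite Rinv_inv; ring).
  destruct (critical_orbit c a) as (E1 & E2 & E3 & E4); [lra|exact Ec|].
  set (s := scale a) in *.
  assert (Eh : uk c 4 = hi c s).
  { assert (K : uk c 4 - c = (uk c 4 - c) / (uk c 4 - uk c 1) * (uk c 4 - uk c 1))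
      by (field; lra).
    rewrite Heq, E1 in K. unfold lo, hi in *.
    apply Rmult_eq_reg_r with (1 - c); lra. }
  assert (Hb : balance a = 0) by lra.
  assert (Hs : 0 < s) by (rewrite Eh, E1 in H41; unfold lo, hi in H41; lra).
  assert (R1 := balance_reduced a Hs Hb). fold s in R1.
  set (v := reduced a) in *.
  assert (Ew : height a = s * v) by (unfold v, reduced, height; fold s; ring).
  assert (Es : s = a * (a - 1) ^ 2 - 1) by reflexivity.
  assert (Hw : s * v < a - 1 - s).
  { rewrite E1, E3, Ew in H13. unfold lo in H13.
    assert (K : s * v / a * a = s * v) by (field; lra).
    assert (K2 : (c - s * (1 - c)) * a = a - 1 - s) by nra.
    nra. }
  assert (Hp : a * s ^ 2 < 1).
  { rewrite Eh, E2 in H24. unfold hi in H24.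
    assert (s ^ 2 < 1 - c) by nra. nra. }
  (* As [1 - a z^2] is even in [z], the inequality [u_c^3 (0) < u_c (0)]
     compares the absolute values of the coordinates [1 - a s^2] and [1 - a] of
     [u_c^2 (0)] and [0]. *)
  assert (Hp2 : a * s ^ 2 < 2 - a).
  { assert (K : a * (1 - (1 - a * s ^ 2) ^ 2) < a * (1 - (a - 1) ^ 2)).
    { replace (a * (1 - (1 - a * s ^ 2) ^ 2)) with (s * v)
        by (unfold v, reduced; fold s; ring).
      replace (a * (1 - (a - 1) ^ 2)) with (a - 1 - s) by (rewrite Es; ring).
      exact Hw. }
    assert (K2 : (a - 1) ^ 2 < (1 - a * s ^ 2) ^ 2) by nra.
    nra. }
  assert (Hv : a ^ 3 * s < v).
  { unfold v, reduced. fold s.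
    assert (0 < a ^ 2 * s) by (apply Rmult_lt_0_compat; nra). nra. }
  assert (Hsv : 0 < v) by (assert (0 < a ^ 3 * s) by (apply Rmult_lt_0_compat; [apply pow_lt|]; lra); lra).
  assert (Hlow : 7 / 4 < a).
  { destruct (Rlt_dec (7 / 4) a) as [|N]; [assumption|exfalso].
    assert ((a - 1) ^ 2 <= 9 / 16) by nra. nra. }
  assert (Hv1 : v * (a - 1) < 1) by nra.
  assert (Hup : a < 91 / 50).
  { destruct (Rlt_dec a (91 / 50)) as [|N]; [assumption|exfalso].
    assert (6724 / 10000 <= (a - 1) ^ 2) by nra.
    assert (223 / 1000 <= s) by nra.
    assert (33124 / 10000 <= a ^ 2) by nra.
    assert (6 <= a ^ 3) by (replace (a ^ 3) with (a * a ^ 2) by ring; nra).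
    assert (6 * (223 / 1000) <= a ^ 3 * s) by (apply Rmult_le_compat; lra).
    assert (4 / 3 * (82 / 100) <= v * (a - 1)) by (apply Rmult_le_compat; lra).
    lra. }
  assert (Hs1 : s < 224 / 1000).
  { assert ((a - 1) ^ 2 < 6724 / 10000) by nra. nra. }
  assert (Hv2 : v < 4 / 3) by nra.
  assert (Hv3 : v < 21 / 25).
  { assert (s * v < 3 / 10) by nra. nra. }
  assert (Hup2 : a < 9 / 5).
  { destruct (Rlt_dec a (9 / 5)) as [|N]; [assumption|exfalso].
    assert (64 / 100 <= (a - 1) ^ 2) by nra.
    assert (152 / 1000 <= s) by nra.
    assert (324 / 100 <= a ^ 2) by nra.
    assert (583 / 100 <= a ^ 3) by (replace (a ^ 3) with (a * a ^ 2) by ring; nra).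
    assert (583 / 100 * (152 / 1000) <= a ^ 3 * s) by (apply Rmult_le_compat; lra).
    lra. }
  repeat split; auto.
  assert ((a - 1) ^ 2 < 64 / 100) by nra. nra.
Qed.

(** On the range of [c_star_range], [reduced] increases at least five times as fast as [scale],
    so the left-hand side of the equation is increasing. *)
Lemma reduced_solution_unique a b :
  7 / 4 < a -> a < b -> b < 9 / 5 ->
  0 < scale a -> scale b < 19 / 125 ->
  0 < reduced a < 21 / 25 -> 0 < reduced b < 21 / 25 ->
  reduced a * (2 * (a - 1) - scale a * reduced a) = 1 ->
  reduced b * (2 * (b - 1) - scale b * reduced b) = 1 -> False.
Proof.
  intros Ha Hab Hb Hsa Hsb Hva Hvb Ea Eb.
  assert (Hs : scale a < scale b).
  { replace (scale b) with (scale a + (b - a) *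
      ((a - 1) ^ 2 + b * (a + b - 2))) by (unfold scale; ring).
    assert (0 < (b - a) * ((a - 1) ^ 2 + b * (a + b - 2)))
      by (apply Rmult_lt_0_compat; nra).
    lra. }
  assert (Hv : 5 * (scale b - scale a) <= reduced b - reduced a).
  { unfold reduced.
    set (x := scale a) in *. set (y := scale b) in *.
    assert (K1 : 0 <= y * ((b - a) * (2 * (a + b) - (b ^ 2 + a * b + a ^ 2) * y ^ 2))).
    { apply Rmult_le_pos; [lra|]. apply Rmult_le_pos; [lra|].
      assert (y ^ 2 < 1 / 25) by nra.
      assert (0 < b ^ 2 + a * b + a ^ 2 < 10) by nra. nra. }
    assert (K2 : 5 <= a ^ 2 * (2 - a * (y ^ 2 + x * y + x ^ 2))).
    { assert (0 < y ^ 2 + x * y + x ^ 2 < 9 / 125) by nra.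
      assert (3 < a ^ 2) by nra.
      assert (5 / 3 < 2 - a * (y ^ 2 + x * y + x ^ 2)) by nra. nra. }
    replace (b ^ 2 * y * (2 - b * y ^ 2) - a ^ 2 * x * (2 - a * x ^ 2)) with
      (y * ((b - a) * (2 * (a + b) - (b ^ 2 + a * b + a ^ 2) * y ^ 2))
       + (y - x) * (a ^ 2 * (2 - a * (y ^ 2 + x * y + x ^ 2)))) by ring.
    nra. }
  set (x := scale a) in *. set (y := scale b) in *.
  set (v := reduced a) in *. set (w := reduced b) in *.
  assert (E : 2 * (b - a) * w + (w - v) * (2 * (a - 1) - y * (w + v))
              - (y - x) * v ^ 2 = 0) by lra.
  assert (K : 1 <= 2 * (a - 1) - y * (w + v)).
  { assert (y * (w + v) <= 19 / 125 * (42 / 25)) by (apply Rmult_le_compat; lra).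
    lra. }
  assert (K2 : v ^ 2 < 1) by nra.
  assert (K3 : 5 * (y - x) <= (w - v) * (2 * (a - 1) - y * (w + v))) by nra.
  assert (K4 : (y - x) * v ^ 2 <= y - x) by nra.
  assert (K5 : 0 < (b - a) * w) by (apply Rmult_lt_0_compat; lra).
  lra.
Qed.

Lemma c_star_unique c c' : c_star_eq c -> c_star_eq c' -> c = c'.
Proof.
  intros H H'.
  destruct (c_star_range c H) as (E & A & S & V & Q).
  destruct (c_star_range c' H') as (E' & A' & S' & V' & Q').
  rewrite E, E'. do 2 f_equal.
  destruct (Rtotal_order (/ (1 - c)) (/ (1 - c'))) as [L|[L|L]]; [exfalso|exact L|exfalso].
  - apply (reduced_solution_unique _ _ (proj1 A) L); tauto.
  - apply (reduced_solution_unique _ _ (proj1 A') L); tauto.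
Qed.

(** The end points are chosen inside the range of [1 / (1 - c)] for [c] within
    [5 / 10 ^ 7] of [0.440262]; the sign change is exact rational arithmetic. *)
Lemma balance_root :
  exists a, 17865486 / 10000000 <= a <= 1786549 / 1000000 /\ balance a = 0.
Proof.
  destruct (IVT balance (17865486 / 10000000) (1786549 / 1000000))
    as (a & Ha & E).
  - unfold balance, height, scale. reg.
  - lra.
  - unfold balance, height, scale. lra.
  - unfold balance, height, scale. lra.
  - exists a. auto.
Qed.

Lemma geometry_numeric c s r :
  440 / 1000 <= c <= 4405 / 10000 ->
  1052 / 10000 <= s <= 1053 / 10000 ->
  391 / 10000 <= r <= 393 / 10000 -> geometry c s r.
Proof.
  intros Hc Hs Hr.
  assert (Hs2 : 1106 / 100000 <= s ^ 2 <= 1109 / 100000) by nra.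
  assert (Hlo : 380 / 1000 <= lo c s <= 382 / 1000) by (unfold lo; nra).
  assert (Hhi : 486 / 1000 <= hi c s <= 487 / 1000) by (unfold hi; nra).
  assert (D : forall x y m, 0 < y -> x <= m * y -> x / y <= m).
  { intros x y m Hy Hxy. apply Rmult_le_reg_r with y; [exact Hy|].
    unfold Rdiv. rewrite Rmult_assoc, Rinv_l; lra. }
  assert (D1 : s / r <= 27 / 10) by (apply D; lra).
  assert (D2 : r / s <= 38 / 100) by (apply D; lra).
  assert (D3 : r / s ^ 2 <= 36 / 10) by (apply D; lra).
  assert (D4 : s ^ 2 / r <= 29 / 100) by (apply D; lra).
  split; try lra; unfold bez1, bez2.
  - nra.
  - nra.
Qed.

Lemma c_star_exists : exists c s r,
  c_star_eq c /\ Rabs (c - 440262 / 1000000) <= 5 / 10000000 /\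
  geometry c s r /\ orbit c s r.
Proof.
  destruct balance_root as (a & Ha & Hb).
  set (c := 1 - / a).
  assert (Hac : a * (1 - c) = 1) by (unfold c; field; lra).
  destruct (critical_orbit c a) as (E1 & E2 & E3 & E4); [lra|reflexivity|].
  assert (Hc : 4402615 / 10000000 <= c <= 4402625 / 10000000) by nra.
  assert (Hs : 1052 / 10000 <= scale a <= 1053 / 10000).
  { assert (618658 / 1000000 <= (a - 1) ^ 2 <= 618660 / 1000000) by nra.
    unfold scale. nra. }
  assert (Hr : 391 / 10000 <= height a / a <= 393 / 10000).
  { assert (Hs2 : 11067 / 1000000 <= scale a ^ 2 <= 11089 / 1000000) by nra.
    replace (height a / a) with (a * scale a ^ 2 * (2 - a * scale a ^ 2))
      by (unfold height; field; lra).
    assert (1977 / 100000 <= a * scale a ^ 2 <= 1982 / 100000) by nra. nra. }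
  assert (G : geometry c (scale a) (height a / a)) by (apply geometry_numeric; lra).
  rewrite Hb, Rplus_0_r in E4.
  exists c, (scale a), (height a / a).
  split; [|split; [apply Rabs_le; lra|split; [exact G|repeat split; assumption]]].
  pose proof (lo_hi _ _ _ G) as H.
  assert (E : hi c (scale a) - lo c (scale a) = scale a) by (unfold hi, lo; ring).
  split.
  - unfold F_d. rewrite E1, E2, E3, E4. repeat split; nra.
  - rewrite E1, E4, E. unfold hi. field. lra.
Qed.

Theorem theorem2p7 :
  exists c_star : R,
    unique c_star_eq c_star /\
    Rabs (c_star - 440262 / 1000000) <= 5 / 10000000 /\
    exists (F : R -> R) (c : R),
      unimodal F c /\
      C1Lip F /\
      quadratic_tip F c /\
      infinitely_renormalizable F /\
      extends_f_s c_star F /\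
      (forall x, I01 x -> renorm F x = F x).
Proof.
  destruct c_star_exists as (c & s & r & Hc & Hnum & G & O).
  exists c. split; [split; [exact Hc|intros c'; apply c_star_unique; exact Hc]|].
  split; [exact Hnum|].
  destruct (renormalization_fixed_point c s r G O) as [F HF].
  exists F, c. exact HF.
Qed.
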